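(* Let $m>1$ be an integer and let $A=\mathbb{Z}_2\times\cdots\times\mathbb{Z}_2$ be the direct product of $m$ copies of $\mathbb{Z}_2$ (so $|A|=2^m$). Then the paths $P_{2^m}$ and $P_{2^m+1}$ are not $A$-cordial. In particular, $A$ is not $\mathbb{P}$-cordial.
   Context: For a finite abelian group $A$ of order $n$ (written additively) and a graph $G$, a vertex labeling $\ell:V(G)\to A$ induces an edge labeling assigning to each edge $uv$ the label $\ell(u)+\ell(v)$. Let $\lambda^v=(\lambda^v_1\ge\dots\ge\lambda^v_n\ge 0)$ be the numbers of vertices carrying each element of $A$ (over all $n$ elements, arranged in decreasing order, zeros allowed), and $\lambda^e$ the analogous sequence for edge labels. A sequence $\lambda=(\lambda_1\ge\lambda_2\ge\cdots)$ is almost rectangular if $\lambda_i\in\{\lambda_1,\lambda_1-1,0\}$ for all $i$. The graph $G$ is $A$-cordial if some vertex labeling by $A$ makes both $\lambda^v$ and $\lambda^e$ almost rectangular. $P_k$ denotes the path graph with $k$ vertices, and $\mathbb{P}$ the class of all path graphs; $A$ is $\mathbb{P}$-cordial if every path graph is $A$-cordial.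
   Formalization: ''Almost rectangular'' is taken to mean that each of the n label counts is λ_1 or λ_1−1; the value 0 is not separately permitted among these counts, since otherwise a constant labeling would make every path A-cordial and the claim false. *)

(* Defs.v *)
From HB Require Import structures.
From mathcomp Require Import all_boot all_order all_algebra.

Set Implicit Arguments.
Unset Strict Implicit.
Unset Printing Implicit Defensive.

Import GRing.Theory.
Local Open Scope ring_scope.

Record sgraph := SGraph {
  vertex :> finType;
  adj : rel vertex;
  adj_sym : symmetric adj;
  adj_irr : irreflexive adj
}.

Definition edges (G : sgraph) : {set {set G}} :=
  [set e : {set G} |
    [exists u : G, exists v : G, adj u v && (e == [set u; v])]].

(* As an edge has two distinct endpoints u and v, this is l u + l v on it. *)
Definition edge_label (A : finZmodType) (G : sgraph) (l : G -> A)
  (e : {set G}) : A := \sum_(u in e) l u.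

Definition vertex_counts (A : finZmodType) (G : sgraph) (l : G -> A) :
  seq nat := sort geq [seq #|[set v : G | l v == a]| | a : A].

Definition edge_counts (A : finZmodType) (G : sgraph) (l : G -> A) :
  seq nat := sort geq [seq #|[set e in edges G | edge_label l e == a]| | a : A].

(* A finite sequence stands for its extension by infinitely many zeros. The
   value 0 permitted by "s_i is in {s_1, s_1 - 1, 0} for all i" is that of the
   padding entries: if it were also permitted among the listed entries (one for
   each group element), every constant labeling would make the label counts of
   any graph almost rectangular. So counts are almost rectangular when they
   pairwise differ by at most 1, as in Hovey's definition of A-cordiality. *)
Definition almost_rectangular (s : seq nat) : bool :=
  all (fun x : nat => (x == head 0%N s) || (x == (head 0%N s).-1)) s.

Definition cordial (A : finZmodType) (G : sgraph) : Prop :=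
  exists l : G -> A,
    almost_rectangular (vertex_counts l) /\ almost_rectangular (edge_counts l).

Definition path_adj (k : nat) : rel 'I_k :=
  fun i j => ((i.+1 == j :> nat) || (j.+1 == i :> nat))%N.

Lemma path_adj_sym k : symmetric (@path_adj k).
Proof. by move=> i j; rewrite /path_adj orbC. Qed.

Lemma path_adj_irr k : irreflexive (@path_adj k).
Proof. by move=> i; rewrite /path_adj orbb (gtn_eqF (ltnSn i)). Qed.

Definition path_graph (k : nat) : sgraph :=
  SGraph (@path_adj_sym k) (@path_adj_irr k).

Definition path_cordial (A : finZmodType) : Prop :=
  forall k : nat, (0 < k)%N -> cordial A (path_graph k).

(* Main.v *)
Require Import Defs.
From mathcomp Require Import all_boot all_order all_algebra.

(** In an elementary abelian 2-group the labels of the edges of a path add up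
    to the sum of the labels of its two endpoints. When the path has |A| or
    |A| + 1 vertices, balance forces the edge labels to be pairwise distinct and
    to cover at least A \ {0}; since the elements of A add up to 0 for m > 1,
    the two endpoints get the same label. With |A| vertices this contradicts
    the injectivity of the vertex labeling. With |A| + 1 vertices, all vertices
    but the last then carry distinct labels, so that no edge is labeled 0,
    although every element of A is an edge label. *)

Set Implicit Arguments.
Unset Strict Implicit.
Unset Printing Implicit Defensive.

Import GRing.Theory.

(** * Values that pairwise differ by at most one *)

Section Balanced.

Variables (T : finType) (f : T -> nat).

Lemma almost_rectangular_balanced :
  almost_rectangular (sort geq [seq f a | a : T]) ->
  forall a b, f a <= (f b).+1.
Proof.
rewrite /almost_rectangular all_sort; move: (head _ _) => h /allP hf a b.
have fE c : (f c == h) || (f c == h.-1) by apply/hf/image_f.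
by case/orP: (fE a) => /eqP->; case/orP: (fE b) => /eqP->; case: (h) => //= k;
  rewrite ?leqnSn // ltnW.
Qed.

Hypothesis bal_f : forall a b, f a <= (f b).+1.

(** A value of at least 2 would force all values to be positive, and the sum would exceed [#|T|]. *)
Lemma balanced_le1 : \sum_a f a <= #|T| -> forall a, f a <= 1.
Proof.
move=> le_sum a; rewrite leqNgt; apply/negP => fa_gt1.
have f_gt0 b : 0 < f b by rewrite -ltnS (leq_trans fa_gt1).
move: le_sum; rewrite leqNgt -sum1_card (bigD1 a) //= [ltnRHS](bigD1 a) //=.
by rewrite -addSn leq_add // leq_sum.
Qed.

(** Dually, a value 0 would force all values to be at most 1, and the sum would fall below
    [#|T|]. *)
Lemma balanced_gt0 : #|T| <= \sum_a f a -> forall a, 0 < f a.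
Proof.
move=> ge_sum a; rewrite lt0n; apply/eqP => fa0.
have f_le1 b : f b <= 1 by rewrite -fa0.
move: ge_sum; rewrite leqNgt -sum1_card (bigD1 a) //= [ltnRHS](bigD1 a) //=.
by rewrite fa0 add0n add1n ltnS leq_sum.
Qed.

End Balanced.

Section Fibers.

Variables (S T : finType) (E : {set S}) (g : S -> T).

Let fiber a := #|[set x in E | g x == a]|.

Lemma sum_card_fiber : \sum_a fiber a = #|E|.
Proof.
rewrite -sum1_card (partition_big g predT) //=; apply: eq_bigr => a _.
by rewrite /fiber -sum1dep_card.
Qed.

Hypothesis rect : almost_rectangular (sort geq [seq fiber a | a : T]).

Lemma almost_rectangular_inj : #|E| <= #|T| -> {in E &, injective g}.
Proof.
rewrite -sum_card_fiber.
move=> /(balanced_le1 (almost_rectangular_balanced rect)) le1 x y Ex Ey gxy.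
by apply: (card_le1_eqP (le1 (g x))); rewrite inE ?Ex ?Ey gxy eqxx.
Qed.

Lemma almost_rectangular_onto : #|T| <= #|E| -> g @: E = setT.
Proof.
rewrite -sum_card_fiber.
move=> /(balanced_gt0 (almost_rectangular_balanced rect)) gt0.
apply/setP => a; rewrite inE; have /card_gt0P[x] := gt0 a.
by rewrite inE => /andP[Ex /eqP <-]; apply: imset_f.
Qed.

End Fibers.

(** Puts vertex counts in the fiber form, so that the lemmas on fibers serve vertices and edges
    alike. *)
Lemma vertex_counts_setT (A : finZmodType) (G : sgraph) (l : G -> A) :
  vertex_counts l = sort geq [seq #|[set v in [set: G] | l v == a]| | a : A].
Proof.
congr (sort geq _); apply: eq_map => a.
by apply: eq_card => v; rewrite !inE.
Qed.

(** * Edges of a path and the sum of their labels *)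

Section PathEdges.
Local Open Scope ring_scope.

Variable k : nat.

Definition path_edge (i : 'I_k) : {set 'I_k.+1} :=
  [set widen_ord (leqnSn k) i; lift ord0 i].

Lemma widen_neq_lift0 (i : 'I_k) : widen_ord (leqnSn k) i != lift ord0 i.
Proof. by rewrite -val_eqE /= /bump /= add1n ltn_eqF. Qed.

Lemma path_edge_inj : injective path_edge.
Proof.
move=> i j eij; apply: val_inj => /=.
have /setP/(_ (widen_ord (leqnSn k) i)) := eij.
have /setP/(_ (widen_ord (leqnSn k) j)) := eij.
rewrite !inE !eqxx /= -!val_eqE /= /bump /= !add1n.
case/orP=> [/eqP-> // | /eqP jE] /esym/orP[/eqP-> // | /eqP iE].
(* In the remaining case each of [i] and [j] would be the successor of the other. *)
by move: (ltnn i); rewrite {2}iE jE ltnW ?ltnS.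
Qed.

Lemma edges_path : edges (path_graph k.+1) = path_edge @: setT.
Proof.
apply/setP => e; rewrite inE; apply/existsP/imsetP => [[u /existsP[v]]|[i _ ->]].
  have edgeE (x y : 'I_k.+1) : x.+1 == y -> exists i, [set x; y] = path_edge i.
    move=> /eqP xy; have xk : (x < k)%N by rewrite -ltnS xy ltn_ord.
    exists (Ordinal xk); rewrite /path_edge.
    have -> : widen_ord (leqnSn k) (Ordinal xk) = x by apply: val_inj.
    by have -> : lift ord0 (Ordinal xk) = y by apply: val_inj.
  case/andP=> /orP[] /edgeE[i ei] /eqP ->; exists i; rewrite ?inE //.
  by rewrite setUC.
exists (widen_ord (leqnSn k) i); apply/existsP; exists (lift ord0 i).
by rewrite eqxx andbT /= /path_adj /= /bump /= add1n eqxx.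
Qed.

Lemma card_edges_path : #|edges (path_graph k.+1)| = k.
Proof.
by rewrite edges_path card_imset ?cardsT ?card_ord //; apply: path_edge_inj.
Qed.

Variables (A : finZmodType) (l : 'I_k.+1 -> A).

Lemma edge_label_path i :
  @edge_label A (path_graph k.+1) l (path_edge i) =
    l (widen_ord (leqnSn k) i) + l (lift ord0 i).
Proof.
by rewrite /edge_label /path_edge big_setU1 ?inE ?widen_neq_lift0 //= big_set1.
Qed.

(** An inner vertex lies on two edges, so its label is counted twice and cancels. *)
Lemma sum_edge_label_path : (forall x : A, x + x = 0) ->
  \sum_(e in edges (path_graph k.+1)) @edge_label A (path_graph k.+1) l e =
    l ord0 + l ord_max.
Proof.
move=> A2; rewrite edges_path big_imset /=;
  last by move=> i j _ _; apply: path_edge_inj.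
rewrite (eq_bigl xpredT) => [|i]; last by rewrite inE.
under eq_bigr do rewrite edge_label_path.
rewrite big_split /=.
have l0E : l ord0 + \sum_(i < k) l (lift ord0 i) = \sum_(i < k.+1) l i.
  by rewrite big_ord_recl.
rewrite big_ord_recr /= in l0E.
set sl := \sum_(i < k) l (lift ord0 i) in l0E *.
have -> : l ord0 = l ord0 + sl + sl by rewrite -addrA A2 addr0.
rewrite l0E -!addrA; congr (_ + _).
by rewrite addrCA A2 addr0.
Qed.

End PathEdges.

(** * Paths on |A| and |A| + 1 vertices *)

Section Noncordial.
Local Open Scope ring_scope.

Variable A : finZmodType.
Hypothesis A2 : forall x : A, x + x = 0.
Hypothesis sumA : \sum_(a : A) a = 0.

Lemma addr_eq0_char2 (x y : A) : x + y = 0 -> x = y.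
Proof. by move=> xy; rewrite -[x]addr0 -(A2 y) addrA xy add0r. Qed.

(** By injectivity the sum of the edge labels is the sum over [D]. The set [D] will be A \ {0} for
    |A| vertices and A for |A| + 1. *)
Lemma path_ends_eq k (l : 'I_k.+1 -> A) (D : {set A}) :
    let G := path_graph k.+1 in
    {in edges G &, injective (@edge_label A G l)} ->
    @edge_label A G l @: edges G = D -> \sum_(a in D) a = 0 ->
  l ord0 = l ord_max.
Proof.
move=> G inj imD sumD; apply: addr_eq0_char2.
by rewrite -sum_edge_label_path // -[RHS]sumD -imD big_imset.
Qed.

Lemma path_order_not_cordial k :
  #|A| = k.+1 -> (0 < k)%N -> ~ cordial A (path_graph k.+1).
Proof.
move=> cardA k_gt0 [l [rectV rectE]].
have l_inj : injective l.
  move=> x y; apply: (@almost_rectangular_inj _ _ setT l); rewrite ?inE //.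
    by rewrite -vertex_counts_setT.
  by rewrite cardsT card_ord cardA.
have e_inj := almost_rectangular_inj rectE.
rewrite card_edges_path cardA in e_inj; have {}e_inj := e_inj (leqnSn k).
suff /l_inj/(congr1 val)/= k0 : l ord0 = l ord_max by rewrite -k0 in k_gt0.
apply: (path_ends_eq (D := ~: [set 0])) => //; last first.
  rewrite -[RHS]sumA [RHS](bigD1 0) //= add0r.
  by apply: eq_bigl => a; rewrite !inE.
(* The [k] edge labels are distinct and A \ {0} has [k] elements, so it suffices that no edge is
   labeled 0, which holds as adjacent vertices have distinct labels. *)
apply/eqP; rewrite eqEcard card_in_imset //
  card_edges_path cardsC1 cardA leqnn andbT.
apply/subsetP => a /imsetP[e]; rewrite edges_path => /imsetP[i _ ->] ->.
rewrite edge_label_path !inE; apply/eqP => /addr_eq0_char2/l_inj/eqP.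
by rewrite (negPf (widen_neq_lift0 i)).
Qed.

Lemma path_succ_order_not_cordial k :
  #|A| = k -> (1 < k)%N -> ~ cordial A (path_graph k.+1).
Proof.
move=> cardA k_gt1 [l [rectV rectE]].
have l_onto : l @: setT = setT.
  apply: almost_rectangular_onto.
    by rewrite -vertex_counts_setT.
  by rewrite cardsT card_ord cardA.
have e_inj : {in edges (path_graph k.+1) &, injective (edge_label l)}.
  by apply: almost_rectangular_inj rectE _; rewrite card_edges_path cardA.
have e_onto : edge_label l @: edges (path_graph k.+1) = setT.
  by apply: almost_rectangular_onto rectE _; rewrite card_edges_path cardA.
have l_ends : l ord0 = l ord_max.
  apply: path_ends_eq e_inj e_onto _; rewrite -[RHS]sumA.
  by apply: eq_bigl => a; rewrite inE.
pose w := widen_ord (leqnSn k).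
have lw_inj : injective (l \o w).
  (* The last vertex only repeats the label of vertex 0, so the first [k] vertices already carry all
     [k] elements of A. *)
  suff lw_onto : (l \o w) @: setT = setT.
    suff /imset_injP lw_inj : #|(l \o w) @: setT| == #|[set: 'I_k]|.
      by move=> i j; apply: lw_inj; rewrite inE.
    by rewrite lw_onto !cardsT card_ord cardA.
  apply/setP => a; rewrite inE; have : a \in l @: setT by rewrite l_onto inE.
  case/imsetP=> x _ ->; have [xk|] := ltnP x k.
    have -> : x = w (Ordinal xk) by apply: val_inj.
    exact: (imset_f (l \o w)).
  move=> kx; have -> : x = ord_max.
    by apply/val_inj/eqP; rewrite eqn_leq kx -ltnS ltn_ord.
  rewrite -l_ends; have -> : ord0 = w (Ordinal (ltnW k_gt1)) by apply: val_inj.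
  exact: (imset_f (l \o w)).
have : 0 \in edge_label l @: edges (path_graph k.+1) by rewrite e_onto inE.
case/imsetP=> e; rewrite edges_path => /imsetP[i _ ->].
rewrite edge_label_path => /esym/addr_eq0_char2 li.
(* The edge labeled 0 has equal end labels. Unless it is the last edge, both ends are among the
   first [k] vertices, against [lw_inj]. *)
have [ik|] := ltnP i.+1 k.
  have wE : lift ord0 i = w (Ordinal ik).
    by apply: val_inj; rewrite /= /bump add1n.
  move: li; rewrite wE => /lw_inj/(congr1 val)/= /eqP.
  by rewrite ltn_eqF.
move=> ki; have iE : i.+1 = k by apply/eqP; rewrite eqn_leq ki ltn_ord.
have wE : lift ord0 i = ord_max.
  by apply: val_inj; rewrite /= /bump add1n.
(* On the last edge, vertex [i] would share its label with vertex 0, hence [i] = 0 and [k] = 1. *)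
move: li; rewrite wE -l_ends.
have -> : ord0 = w (Ordinal (ltnW k_gt1)) by apply: val_inj.
by move/lw_inj/(congr1 val) => /= i0; move: k_gt1; rewrite -iE i0.
Qed.

End Noncordial.

Section ElementaryAbelian.
Local Open Scope ring_scope.

Lemma addrr_Z2 m (x : 'rV['Z_2]_m) : x + x = 0.
Proof.
apply/rowP => j; rewrite !mxE; move: (x 0 j).
by case=> [[|[|?]]] //= ?; apply: val_inj.
Qed.

(* The sum is fixed by every automorphism, in particular by the transvection
   adding the j-th coordinate to another one. *)
Lemma sum_rV_Z2 m : (1 < m)%N -> \sum_(a : 'rV['Z_2]_m) a = 0.
Proof.
move=> m_gt1; apply/rowP => j; rewrite summxE mxE.
have [j' jj'] : exists j' : 'I_m, j' != j.
  apply/existsP; rewrite -negb_forall; apply/negP => /forallP all_j.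
  move: m_gt1; rewrite -[m]card_ord ltnNge => /negP; apply.
  by apply/card_le1P => x _ y; rewrite !inE (eqP (all_j x)) (eqP (all_j y)) eqxx.
pose h (a : 'rV['Z_2]_m) := a + a 0 j *: delta_mx 0 j'.
have hK : involutive h.
  move=> a; rewrite /h !mxE eqxx eq_sym (negPf jj') mulr0 addr0.
  by rewrite -addrA addrr_Z2 addr0.
(* Coordinate [j'] of [h a] is [a 0 j' + a 0 j], so reindexing the sum of the [j'] coordinates by
   [h] adds the sum of the [j] coordinates to it. *)
apply: (addrI (\sum_(a : 'rV['Z_2]_m) a 0 j')); rewrite addr0 -big_split /=.
rewrite [RHS](reindex_inj (inv_inj hK)) /=; apply: eq_bigr => a _.
by rewrite !mxE !eqxx mulr1.
Qed.

End ElementaryAbelian.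

Theorem theorem1p5 (m : nat) (hm : (1 < m)%N) :
  [/\ ~ cordial 'rV['Z_2]_m (path_graph (2 ^ m)),
      ~ cordial 'rV['Z_2]_m (path_graph (2 ^ m + 1)) &
      ~ path_cordial 'rV['Z_2]_m].
Proof.
have cardA : #|{: 'rV['Z_2]_m}| = (2 ^ m)%N by rewrite card_mx card_ord mul1n.
have n_gt1 : (1 < 2 ^ m)%N by rewrite -(expn0 2) ltn_exp2l // ltnW.
have not_cordial : ~ cordial 'rV['Z_2]_m (path_graph (2 ^ m)).
  case: (2 ^ m)%N cardA n_gt1 => // k cardA k_gt0.
  exact: path_order_not_cordial (@addrr_Z2 m) (sum_rV_Z2 hm) _ cardA k_gt0.
split=> //; last by move=> /(_ _ (ltnW n_gt1)).
rewrite addn1.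
exact: path_succ_order_not_cordial (@addrr_Z2 m) (sum_rV_Z2 hm) _ cardA n_gt1.
Qed.
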